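(* No product (with the product topology, over a nonempty index set) of infinite compact $\mathscr R_2$-spaces is homogeneous.
   Context: All spaces are completely regular Hausdorff topological spaces. Sets $A,B\subset X$ are separated if $\overline A\cap B=A\cap\overline B=\varnothing$. A set is called discrete if it is discrete in the subspace topology (not necessarily closed). A space $X$ is an $\mathscr R_2$-space if any two separated countable subsets of $X$, one of which is discrete, have disjoint closures in $X$. A space $X$ is homogeneous if for any $x,y\in X$ there is a homeomorphism of $X$ onto itself taking $x$ to $y$. *)

(* Defs.v *)
From HB Require Import structures.
From mathcomp Require Import all_boot all_order all_algebra.
From mathcomp Require Import all_classical all_reals all_analysis.

Set Implicit Arguments.
Unset Strict Implicit.
Unset Printing Implicit Defensive.

Local Open Scope classical_set_scope.

(* The coercion [A : set T >-> Type] sends [A] to its subtype [set_type A],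
   which carries the subspace topology (initial for the inclusion into [T]);
   [A] is not required to be closed in [T]. *)
Definition discrete_subset (T : topologicalType) (A : set T) : Prop :=
  forall U : set A, open U.

(* "Countable" includes finite. *)
Definition R2_space (T : topologicalType) : Prop :=
  forall A B : set T, countable A -> countable B -> separated A B ->
    discrete_subset A \/ discrete_subset B ->
    closure A `&` closure B = set0.

Definition homeomorphism (S T : topologicalType) (f : S -> T) : Prop :=
  continuous f /\
  exists g : T -> S, [/\ continuous g, cancel f g & cancel g f].

Definition homogeneous_space (T : topologicalType) : Prop :=
  forall x y : T, exists2 f : T -> T, homeomorphism f & f x = y.

(* Main.v *)
(* Following Kunen, there are free ultrafilters p and q, on countable sets, such
   that in a Hausdorff R2-space a p-limit x of a sequence of points with pairwise
   disjoint neighbourhoods is never a q-limit of points different from x.  Let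
   every coordinate of x be a p-limit of such a sequence, and let y differ from x
   only in coordinate i0, where it is the q-limit of such a sequence e.  Let h be
   a homeomorphism with h x = y.  The sequence of y with its coordinate i0
   replaced by e_n tends to y along q, so its image z_n under the inverse of h
   tends to x along q, and each coordinate of z_n equals that of x for q-almost
   all n.  The neighbourhood of e_n only restricts finitely many coordinates of
   z_n; resetting the others to those of x and choosing n_k inductively gives an
   ordinary sequence converging to x whose images under h have i0-coordinates in
   disjoint open sets.  These converge in X i0, which R2 forbids.

   The ultrafilter p comes from a transfinite recursion along an independent
   linked matrix of sets, with only finitely many rows used up at each stage. *)
Require Import Defs.
From HB Require Import structures.
From mathcomp Require Import all_boot all_order all_algebra.
From mathcomp Require Import all_classical all_reals all_analysis wochoice.

Local Open Scope classical_set_scope.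

(** * Independent linked matrices *)

Notation bits := (nat -> bool).

Definition cell (S : Type) (A : bits -> bits -> nat -> set S)
    (rows : seq bits) (n : bits -> nat) (sigma : bits -> seq bits) : set S :=
  [set s | forall Y, Y \in rows -> forall X, X \in sigma Y -> A Y X (n Y) s].

(* [A Y X n] is the entry in row [Y] and column [X] at level [n]: any [n]
   columns of a row meet generically, any [n.+1] of them almost not at all. *)
Record linked_matrix (S : Type) (A : bits -> bits -> nat -> set S) : Prop := {
  linked_mono : forall Y X m n, (m <= n)%N -> A Y X m `<=` A Y X n;
  linked_thin : forall Y n (l : seq bits), uniq l -> (n < size l)%N ->
    finite_set [set s | forall X, X \in l -> A Y X n s];
  linked_indep : forall rows n sigma, (forall Y, (size (sigma Y) <= n Y)%N) ->
    infinite_set (cell S A rows n sigma) }.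

Definition window (k : nat) (Y : bits) : {set 'I_k} := [set i : 'I_k | Y i]%SET.

Lemma window_inj (l : seq bits) :
  exists k0, forall k, (k0 <= k)%N -> {in l &, injective (window k)}.
Proof.
pose d (X Y : bits) := xget 0%N [set i | X i != Y i].
exists (\max_(X <- l) \max_(Y <- l) (d X Y).+1)%N => k kk X Y Xl Yl XY.
apply: contrapT => XnY.
have dXY : X (d X Y) != Y (d X Y).
  have : exists i, X i != Y i.
    apply: contrapT => /forallNP h; apply: XnY; apply: funext => i.
    by apply/eqP/negPn/negP; exact: h.
  by move=> /(xgetPex 0%N).
have dk : (d X Y < k)%N.
  by move/bigmax_leqP_seq: kk => /(_ X Xl isT) /bigmax_leqP_seq /(_ Y Yl isT).
move/setP/(_ (Ordinal dk)) : XY; rewrite !inE /= => e.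
by move: dXY; rewrite e eqxx.
Qed.

(* Kunen's index set: a node of level [k] predicts, from the trace of [Y] on
   ['I_k], a family of candidates for the trace of [X]. *)
Definition tree := {k : nat & {ffun {set 'I_k} -> {set {set 'I_k}}}}.

Definition tree_matrix (Y X : bits) (n : nat) : set tree :=
  [set s : tree | (#|tagged s (window (tag s) Y)| <= n)%N &&
           (window (tag s) X \in tagged s (window (tag s) Y))].

Lemma finite_low_tree k0 : finite_set [set s : tree | (tag s < k0)%N].
Proof.
apply: (@sub_finite_set _ _ (\bigcup_(k in `I_k0)
  range (fun f : {ffun {set 'I_k} -> {set {set 'I_k}}} => existT _ k f : tree))).
  by move=> [k f] /= kk; exists k => //; exists f.
apply: bigcup_finite; first exact: finite_II.
move=> k _; apply: finite_image; exact: finite_finset.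
Qed.

(** Thinness: once the windows separate [l], a node in all these entries would predict more than the
    [n] traces allowed, so only nodes of low level remain. Independence: at each large level [k],
    the node [f k] predicts, at the trace of each row [Y], exactly the traces of [sigma Y]; this is
    consistent because the windows separate [rows]. *)
Lemma tree_matrix_linked : linked_matrix tree tree_matrix.
Proof.
split.
- by move=> Y X m n mn s /andP[c x]; rewrite /tree_matrix /= x (leq_trans c mn).
- move=> Y n l ul nl; have [k0 k0P] := window_inj l.
  apply: sub_finite_set (finite_low_tree k0) => -[k f] /= h.
  rewrite ltnNge; apply/negP => kk; have inj := k0P _ kk.
  have [X0 X0l] : exists X0, X0 \in l.
    by case: l nl {ul k0P h inj} => // a l _; exists a; rewrite mem_head.
  have /andP[/= cn _] := h _ X0l.
  have : (size (map (window k) l) <= #|f (window k Y)|)%N.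
    rewrite cardE; apply: uniq_leq_size; first by rewrite map_inj_in_uniq.
    move=> _ /mapP[X Xl ->]; rewrite mem_enum.
    by have /andP[] := h _ Xl.
  by rewrite size_map => /leq_trans /(_ cn); rewrite leqNgt nl.
- move=> rows n sigma szn; have [k0 k0P] := window_inj rows.
  pose f k : {ffun {set 'I_k} -> {set {set 'I_k}}} := [ffun U =>
    [set V | has (fun Y => (window k Y == U) &&
                           (V \in map (window k) (sigma Y))) rows]%SET].
  have fcell k : (k0 <= k)%N ->
      cell tree tree_matrix rows n sigma (existT _ k (f k)).
    move=> kk Y Yr X Xs; rewrite /tree_matrix /=.
    have -> : f k (window k Y) = [set V in map (window k) (sigma Y)]%SET.
      apply/setP => V; rewrite ffunE !inE; apply/hasP/idP.
        by move=> [Z Zr /andP[/eqP /(k0P _ kk _ _ Zr Yr) ->]].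
      by move=> VY; exists Y => //; rewrite eqxx.
    rewrite inE map_f// andbT; apply: leq_trans (szn Y).
    rewrite -(size_map (window k)) cardsE; exact: card_size.
  move=> fin; apply: infinite_nat.
  apply: (@sub_finite_set _ _ (`I_k0 `|` (tag @` cell tree tree_matrix rows n sigma))).
    move=> k _; case: (ltnP k k0) => kk; first by left.
    by right; exists (existT _ k (f k)) => //; exact: fcell.
  by rewrite finite_setU; split; [exact: finite_II | exact: finite_image].
Qed.

(* The rows outside [R] are still independent modulo the filter [F]. *)
Definition free_rows (S : Type) A (F : set_system S) (R : set bits) : Prop :=
  forall B rows n sigma, F B -> (forall Y, Y \in rows -> ~ R Y) ->
    (forall Y, (size (sigma Y) <= n Y)%N) ->
    B `&` cell S A rows n sigma !=set0.

Lemma cell_merge (S : Type) A rows rows' n n' sigma sigma' :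
  (forall Y, Y \in rows -> Y \notin rows') ->
  cell S A (rows ++ rows') (fun Y => if Y \in rows then n Y else n' Y)
    (fun Y => if Y \in rows then sigma Y else sigma' Y) `<=`
  cell S A rows n sigma `&` cell S A rows' n' sigma'.
Proof.
move=> dis s h; split => Y Yr X Xs.
  by have := h Y; rewrite mem_cat Yr /= => /(_ isT X Xs).
have := h Y; rewrite mem_cat Yr orbT /=.
case: ifPn => [Y1 |_ /(_ isT X Xs)//].
by have := dis _ Y1; rewrite Yr.
Qed.

Lemma size_merge (rows : seq bits) (n n' : bits -> nat)
    (sigma sigma' : bits -> seq bits) :
  (forall Y, (size (sigma Y) <= n Y)%N) -> (forall Y, (size (sigma' Y) <= n' Y)%N) ->
  forall Y, (size (if Y \in rows then sigma Y else sigma' Y) <=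
             if Y \in rows then n Y else n' Y)%N.
Proof. by move=> h h' Y; case: ifP. Qed.

Definition adjoin {S : Type} (F : set_system S) (C : set S) : set_system S :=
  [set B | exists2 D, F D & D `&` C `<=` B].

Lemma adjoin_filter {S : Type} (F : set_system S) C : Filter F -> Filter (adjoin F C).
Proof.
move=> FF; split.
- by exists setT => //; exact: filterT.
- move=> P Q [D FD DP] [E FE EQ]; exists (D `&` E); first exact: filterI.
  by move=> s [[Ds Es] Cs]; split; [exact: DP | exact: EQ].
- by move=> P Q PQ [D FD DP]; exists D => //; exact: subset_trans PQ.
Qed.

Lemma adjoin_sub {S : Type} (F : set_system S) C : F `<=` adjoin F C.
Proof. by move=> B FB; exists B => // s []. Qed.

Lemma adjoin_self {S : Type} (F : set_system S) C : Filter F -> adjoin F C C.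
Proof. by move=> FF; exists setT; [exact: filterT | move=> s []]. Qed.

(** The adjoined cell and a cell over other free rows merge into a single cell, so adjoining a cell
    costs only its own rows. *)
Lemma free_rows_cell (S : Type) A (F : set_system S) R rows n sigma :
  free_rows S A F R -> (forall Y, Y \in rows -> ~ R Y) ->
  (forall Y, (size (sigma Y) <= n Y)%N) ->
  free_rows S A (adjoin F (cell S A rows n sigma)) (R `|` [set` rows]).
Proof.
move=> fr rR sz B rows' n' sigma' [D FD DB] rR' sz'.
have [|s [Ds cs]] := fr D (rows ++ rows') _ _ FD _
  (size_merge rows _ _ _ _ sz sz').
  by move=> Y; rewrite mem_cat => /orP[/rR//|/rR' h RY]; apply: h; left.
have [|c1 c2] := cell_merge _ _ _ _ _ _ _ _ _ _ cs; last by exists s; split => //; exact: DB.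
move=> Y Yr; apply/negP => /rR'; apply; right; exact: Yr.
Qed.

(* [Q] can be forced by enlarging the filter at the cost of finitely many rows. *)
Definition achievable (S : Type) A (Q : set_system S -> Prop) : Prop :=
  forall F R, Filter F -> (forall B, finite_set (~` B) -> F B) ->
    free_rows S A F R -> (exists Y, ~ R Y) ->
    exists F' (rows : seq bits), [/\ Filter F', F `<=` F', Q F' &
      free_rows S A F' (R `|` [set` rows])].

(** Two columns of a free row have finite intersection at level 1, so their preimages and that of
    the complement of the intersection cannot all lie in [q]. A column whose preimage is missing is
    adjoined; otherwise the cofinite complement, already in [F], serves as [B]. *)
Lemma achievable_avoid (S : Type) A (q : set_system nat) (phi : nat -> S) :
  linked_matrix S A -> ProperFilter q ->
  achievable S A (fun F => exists2 B, F B & ~ q (phi @^-1` B)).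
Proof.
move=> mA qF F R FF cofF fr [Y RY].
pose C b := cell S A [:: Y] (fun=> 1%N) (fun=> [:: (fun=> b)]).
have step b : ~ q (phi @^-1` C b) -> exists F' (rows : seq bits),
    [/\ Filter F', F `<=` F', (exists2 B, F' B & ~ q (phi @^-1` B)) &
      free_rows S A F' (R `|` [set` rows])].
  move=> nq; exists (adjoin F (C b)), [:: Y]; split.
  - exact: adjoin_filter.
  - exact: adjoin_sub.
  - by exists (C b) => //; exact: adjoin_self.
  - by apply: free_rows_cell => // Z; rewrite inE => /eqP ->.
have [q1|/step//] := pselect (q (phi @^-1` C true)).
have [q2|/step//] := pselect (q (phi @^-1` C false)).
exists F, [::]; split => //; last first.
  by rewrite (_ : [set` [::]] = set0) ?setU0//; apply/seteqP; split.
exists (~` (C true `&` C false)).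
  apply: cofF; rewrite setCK.
  apply: (sub_finite_set _ (linked_thin _ _ mA Y 1%N
    [:: (fun=> true); (fun=> false)] _ isT)).
    move=> s [h1 h2] X; rewrite !inE => /orP[] /eqP ->.
      by apply: h1; rewrite mem_head.
    by apply: h2; rewrite mem_head.
  rewrite /= inE andbT; apply/eqP => e.
  by have := congr1 (fun u : bits => u 0%N) e.
move=> q3.
have q4 : q (phi @^-1` (~` (C true `&` C false)) `&` (phi @^-1` C true `&` phi @^-1` C false)).
  by apply: filterI => //; exact: filterI.
by have [k [/= nk [k1 k2]]] := filter_ex q4; apply: nk.
Qed.

(* Kunen's OK condition for the decreasing sequence of sets [n <= nu]: if these
   are all in the filter, it contains continuum many sets any [n.+1] of which
   have almost all of their intersection inside [n < nu]. *)
Definition ok_at {S : Type} (nu : S -> nat) (F : set_system S) : Prop :=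
  (exists n, F [set s | (nu s < n)%N]) \/
  exists A : bits -> set S, (forall X, F (A X)) /\
    forall n (l : seq bits), uniq l -> (n < size l)%N ->
      finite_set [set s | (nu s <= n)%N /\ forall X, X \in l -> A X s].

(** If some member of [F] and some cell over free rows together bound [nu], adjoining that cell
    gives the first alternative. Otherwise one free row is spent on the diagonal sets [D X],
    adjoined together with all the sets where [n <= nu]. *)
Lemma achievable_ok (S : Type) A (nu : S -> nat) :
  linked_matrix S A -> achievable S A (ok_at nu).
Proof.
move=> mA F R FF cofF fr [Y RY].
have [[n [B [rows [m [sigma [FB rR sz dis]]]]]]|pos] := pselect (exists n B (rows : seq bits) m sigma,
    [/\ F B, forall Y, Y \in rows -> ~ R Y, forall Y, (size (sigma Y) <= m Y)%N &
     B `&` cell S A rows m sigma `<=` [set s | (nu s < n)%N]]).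
  exists (adjoin F (cell S A rows m sigma)), rows; split.
  - exact: adjoin_filter.
  - exact: adjoin_sub.
  - by left; exists n, B.
  - exact: free_rows_cell.
(* On [N <= nu], [D X] contains [A Y X N]; on [nu <= n] it lies in [A Y X n]. *)
pose D X : set S := [set s | A Y X (nu s) s].
pose F' : set_system S := [set B | exists E n (l : seq bits), F E /\
  [set s | [/\ E s, (n <= nu s)%N & forall X, X \in l -> D X s]] `<=` B].
exists F', [:: Y]; split.
- split.
  + by exists setT, 0%N, [::]; split => //; exact: filterT.
  + move=> P Q [E [n [l [FE EP]]]] [E' [n' [l' [FE' EQ]]]].
    exists (E `&` E'), (maxn n n'), (l ++ l'); split; first exact: filterI.
    move=> s [[Es Es']]; rewrite geq_max => /andP[ns ns'] h; split.
      by apply: EP; split => // X Xl; apply: h; rewrite mem_cat Xl.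
    by apply: EQ; split => // X Xl; apply: h; rewrite mem_cat Xl orbT.
  + move=> P Q PQ [E [n [l [FE EP]]]]; exists E, n, l; split => //.
    exact: subset_trans PQ.
- by move=> B FB; exists B, 0%N, [::]; split => // s [].
- right; exists D; split.
    move=> X; exists setT, 0%N, [:: X]; split; first exact: filterT.
    by move=> s [_ _]; apply; rewrite mem_head.
  move=> n l ul nl; apply: sub_finite_set (linked_thin _ _ mA Y n l ul nl).
  by move=> s [ns h] X Xl; apply: (linked_mono _ _ mA _ _ _ _ ns); exact: h.
- move=> B rows n sigma [E [m [l [FE EB]]]] rR sz.
  (* [N] bounds [m], the tail required with [E], and [size l], so that the columns [l] of row [Y]
     form an admissible request at level [N]. Were [B] to miss the given cell, the merged cell would
     bound [nu] by [N] on [E], against [pos]. *)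
  pose N := maxn m (size l).
  apply: contrapT => emp; apply: pos.
  exists N, E, ([:: Y] ++ rows).
  exists (fun Z => if Z \in [:: Y] then N else n Z).
  exists (fun Z => if Z \in [:: Y] then l else sigma Z).
  split => //.
  + move=> Z; rewrite mem_cat inE => /orP[/eqP -> //|/rR h RZ].
    by apply: h; left.
  + by apply: (size_merge [:: Y] (fun=> N) n (fun=> l)) => // _; exact: leq_maxr.
  + move=> s [Es cs]; rewrite /= ltnNge; apply/negP => Ns; apply: emp.
    have [|h1 h2] := cell_merge _ _ [:: Y] rows (fun=> N) n (fun=> l) sigma _ _ cs.
      move=> Z; rewrite inE => /eqP ->; apply/negP => /rR; apply; right.
      exact: mem_head.
    exists s; split => //; apply: EB; split => //.
      exact: leq_trans (leq_maxl _ _) Ns.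
    move=> X Xl; apply: (linked_mono _ _ mA _ _ _ _ Ns).
    by apply: (h1 Y _ X Xl); rewrite mem_head.
Qed.

(** * The transfinite recursion *)

Lemma wf_definition {T St : Type} (lt : T -> T -> Prop) (d : St)
    (G : T -> (T -> St) -> St) : well_founded lt ->
  exists st : T -> St,
    forall t, st t = G t (fun s => if pselect (lt s t) then st s else d).
Proof.
move=> wf.
pose ext t (rec : forall s, lt s t -> St) s :=
  match pselect (lt s t) with left h => rec s h | right _ => d end.
exists (Fix wf (fun _ => St) (fun t rec => G t (ext t rec))) => t.
rewrite Fix_eq; last first.
  move=> x f g fg; congr (G _ _); apply: funext => s.
  by rewrite /ext; case: pselect.
by congr (G _ _); apply: funext => s; rewrite /ext; case: pselect.
Qed.

(* If [P] does not map onto the continuum, finitely many elements for each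
   point of [P] do not exhaust it either, since [bits] is in bijection with
   [nat -> bits]: diagonalize coordinatewise. *)
Lemma bits_konig (P : set bits) (r : bits -> seq bits) :
  (forall h : bits -> bits, exists y, forall s, P s -> h s <> y) ->
  exists y, forall s, P s -> y \notin r s.
Proof.
move=> hP.
pose dec (y : bits) (n : nat) : bits := fun m => y (pickle (n, m)).
have [z zP] := choice (fun n => hP (fun s => dec (nth (fun=> false) (r s) n) n)).
pose y : bits := fun k =>
  if unpickle k is Some p then z (p : nat * nat).1 p.2 else false.
exists y => s Ps; apply/negP => yr.
apply: (zP (index y (r s)) s Ps); rewrite nth_index//.
by apply: funext => m; rewrite /dec /y pickleK.
Qed.

(* [D] is an initial segment of minimal order type mapping onto [T]. *)
Lemma initial_well_order (T : eqType) :
  exists (lt : T -> T -> Prop) (D : set T) (f : T -> T),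
  [/\ well_founded lt, forall s t, lt s t \/ s = t \/ lt t s,
      forall s t u, lt s t -> lt t u -> lt s u,
      forall s t, D t -> lt s t -> D s &
      (forall y, exists2 t, D t & f t = y) /\
      (forall t, D t -> forall h : T -> T, exists y, forall s, lt s t -> h s <> y)].
Proof.
have [R wo] := well_ordering_principle T.
have wmin (P : T -> Prop) : (exists x, P x) -> exists2 z, P z & forall x, P x -> R z x.
  move=> [x Px]; have [|z [[zP zm] _]] := wo [pred x | `[< P x >]].
    by exists x; exact/asboolP.
  exists z; first exact/asboolP.
  by move=> w Pw; apply: zm; exact/asboolP.
have uniqmin x y : R x y -> R y x -> x = y.
  move=> xy yx; have [|z [_ zu]] := wo (mem [:: x; y]).
    by exists x; exact: mem_head.
  have rfl u : R u u.
    by have [|v -> h] := wmin (eq u); [exists u | exact: h].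
  rewrite -(zu x) ?(zu y)//; split.
  - by rewrite !inE eqxx orbT.
  - by move=> w; rewrite !inE => /orP[] /eqP ->.
  - by rewrite !inE eqxx.
  - by move=> w; rewrite !inE => /orP[] /eqP ->.
have tot x y : R x y \/ R y x.
  have [|z [->|->] h] := wmin (fun u => u = x \/ u = y); first by exists x; left.
    by left; apply: h; right.
  by right; apply: h; left.
have tr x y z : R x y -> R y z -> R x z.
  move=> xy yz; have [|u [->|[->|->]] h] := wmin (fun u => u = x \/ u = y \/ u = z).
  - by exists x; left.
  - by apply: h; right; right.
  - by rewrite (uniqmin x y xy) //; apply: h; left.
  - by rewrite -(uniqmin y z yz) //; apply: h; right; left.
pose lt x y := R x y /\ x <> y.
have ltN x y : ~ lt x y -> R y x.
  by move=> h; case: (tot x y) => // xy; have [->|n] := pselect (x = y);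
    [case: (tot y y) | case: h].
have wf : well_founded lt.
  move=> x; apply: contrapT => nx.
  have [|z nz zm] := wmin (fun x => ~ Acc lt x); first by exists x.
  apply: nz; constructor => y [yz yNz]; apply: contrapT => /zm zy.
  by apply: yNz; exact: uniqmin.
have tri s t : lt s t \/ s = t \/ lt t s.
  have [->|n] := pselect (s = t); first by right; left.
  by case: (tot s t) => h; [left|right; right]; split=> // e; apply: n.
have ltr s t u : lt s t -> lt t u -> lt s u.
  move=> [st sNt] [tu tNu]; split; first exact: tr tu.
  by move=> e; apply: sNt; apply: uniqmin => //; rewrite e.
pose big t := exists h : T -> T, forall y, exists2 s, lt s t & h s = y.
have small t : ~ big t ->
    forall h : T -> T, exists y, forall s, lt s t -> h s <> y.
  move=> nb h; apply: contrapT => /forallNP hn; apply: nb; exists h => y.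
  apply: contrapT => ny; apply: (hn y) => s st e; apply: ny; by exists s.
have [/wmin[t [f fP] tm]|nb] := pselect (exists t, big t).
  exists lt, [set s | lt s t], f; split => //; first by move=> s u ut su; exact: ltr ut.
  split => // u [ut uNt]; apply: small => /tm tu.
  by apply: uNt; exact: uniqmin.
exists lt, setT, id; split => //; split; first by move=> y; exists y.
by move=> t _; apply: small => bt; apply: nb; exists t.
Qed.

(** Stage [t] of the recursion extends the earlier filters and the cofinite sets so as to satisfy
    [Q (g (f t))], spending finitely many rows. Monotonicity of [Q] passes each requirement on to
    the union of all stages. *)
Lemma generic_filter {S J : Type} A (g : bits -> J) (Q : J -> set_system S -> Prop) :
  linked_matrix S A -> (forall j, exists Y, g Y = j) ->
  (forall j F G, F `<=` G -> Q j F -> Q j G) ->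
  (forall j, achievable S A (Q j)) ->
  exists F, [/\ ProperFilter F, forall B, finite_set (~` B) -> F B & forall j, Q j F].
Proof.
move=> mA gsurj Qmono Qach.
have [lt [D [f [wf tri tr Dseg [fsurj small]]]]] :=
  initial_well_order (bits : eqType).
pose stT := (set_system S * seq bits)%type.
pose limF t (st : bits -> stT) : set_system S :=
  [set B | finite_set (~` B) \/ exists2 s, lt s t & (st s).1 B].
pose limR t (st : bits -> stT) : set bits :=
  [set Y | exists2 s, lt s t & Y \in (st s).2].
pose good t st (x : stT) := [/\ Filter x.1, limF t st `<=` x.1,
  Q (g (f t)) x.1 & free_rows S A x.1 (limR t st `|` [set` x.2])].
pose d : stT := (set0, [::]).
have [st stE] := wf_definition lt d (fun t st => xget d (good t st)) wf.
have limE t : limF t (fun s => if pselect (lt s t) then st s else d) = limF t st /\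
    limR t (fun s => if pselect (lt s t) then st s else d) = limR t st.
  split; apply/seteqP; split => B /=.
  - by case=> [?|[s h hB]]; [left|right; exists s => //; move: hB; case: pselect].
  - by case=> [?|[s h hB]]; [left|right; exists s => //; case: pselect].
  - by move=> [s h hB]; exists s => //; move: hB; case: pselect.
  - by move=> [s h hB]; exists s => //; case: pselect.
have goodE t : good t (fun s => if pselect (lt s t) then st s else d) = good t st.
  by rewrite /good; have [-> ->] := limE t.
have stP t : (exists x, good t st x) -> good t st (st t).
  by move=> /(xgetPex d); rewrite (stE t) goodE.
have mono s t : lt s t -> good t st (st t) -> (st s).1 `<=` (st t).1.
  by move=> ls [_ h _ _] B FB; apply: h; right; exists s.
have key t : D t -> good t st (st t).
  elim/(well_founded_ind wf): t => t IH Dt; apply: stP.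
  have gs s : lt s t -> good s st (st s) by move=> ls; apply: IH => //; exact: Dseg ls.
  have FlF : Filter (limF t st).
    split.
    - by left; rewrite setCT.
    - move=> P P' [fP|[s ls sP]] [fP'|[s' ls' sP']].
      + by left; rewrite setCI finite_setU.
      + right; exists s' => //; have [FF h _ _] := gs _ ls'.
        by apply: filterI => //; apply: h; left.
      + right; exists s => //; have [FF h _ _] := gs _ ls.
        by apply: filterI => //; apply: h; left.
      + have [l|[e|l]] := tri s s'.
        * right; exists s' => //; have [FF _ _ _] := gs _ ls'.
          by apply: filterI => //; apply: mono l _ _ _ => //; exact: gs.
        * right; exists s' => //; have [FF _ _ _] := gs _ ls'.
          by apply: filterI => //; rewrite -e.
        * right; exists s => //; have [FF _ _ _] := gs _ ls.
          by apply: filterI => //; apply: mono l _ _ _ => //; exact: gs.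
    - move=> P P' PP' [fP|[s ls sP]].
        by left; apply: sub_finite_set fP; exact: subsetC.
      right; exists s => //; have [FF _ _ _] := gs _ ls.
      exact: filterS PP' _.
  have Ffree : free_rows S A (limF t st) (limR t st).
    move=> B rows n sigma [fB|[s ls sB]] rR sz.
      apply: contrapT => emp; apply: (linked_indep _ _ mA rows n sigma sz).
      apply: sub_finite_set fB => s cs Bs; apply: emp; by exists s.
    have [_ _ _ fr] := gs _ ls; apply: fr => // Y /rR h [[u lu Yu]|Yu]; apply: h.
      by exists u => //; exact: tr ls.
    by exists s.
  have [Y YP] := bits_konig _ (fun s => (st s).2) (small _ Dt).
  have [||F' [rows [FF' sF QF' frF']]] := Qach (g (f t)) _ _ FlF _ Ffree.
  - by move=> B fB; left.
  - by exists Y => -[s ls]; apply/negP; exact: YP.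
  - by exists (F', rows).
have [t0 Dt0 _] := fsurj point.
pose F : set_system S := [set B | exists2 t, D t & (st t).1 B].
have FF : Filter F.
  split.
  - by exists t0 => //; have [FF _ _ _] := key _ Dt0; exact: filterT.
  - move=> P P' [s Ds sP] [s' Ds' sP'].
    have [FF _ _ _] := key _ Ds; have [FF' _ _ _] := key _ Ds'.
    have [l|[e|l]] := tri s s'.
    + exists s' => //; apply: filterI => //; apply: mono l _ _ _ => //; exact: key.
    + by exists s' => //; apply: filterI => //; rewrite -e.
    + exists s => //; apply: filterI => //; apply: mono l _ _ _ => //; exact: key.
  - move=> P P' PP' [s Ds sP]; exists s => //; have [FF _ _ _] := key _ Ds.
    exact: filterS PP' _.
exists F; split.
- apply: Build_ProperFilter_ex => // B [t Dt Bt].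
  have [_ _ _ fr] := key _ Dt.
  (* Freeness for the cell over no rows, which is everything, says that [B] is nonempty. *)
  by have [//|s [Bs _]] := fr B [::] (fun=> 0%N) (fun=> [::]) Bt _ (fun=> leqnn _); exists s.
- by move=> B fB; exists t0 => //; have [_ h _ _] := key _ Dt0; apply: h; left.
- move=> j; have [Y <-] := gsurj j; have [t Dt <-] := fsurj Y.
  have [_ _ h _] := key _ Dt; apply: Qmono h => B Bt; by exists t.
Qed.

(** * The pair of ultrafilters *)

Definition tree_countType : countType := tree.

(** [kunen_ok] is Kunen's notion of an OK point, with continuum many sets; [kunen_avoid] says that
    no map carries [q] to [p], that is, [p] is not Rudin-Keisler below [q]. *)
Record kunen_pair (S : countType) (p : set_system S) (q : set_system nat) : Prop := {
  kunen_p : UltraFilter p;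
  kunen_p_free : forall B, finite_set (~` B) -> p B;
  kunen_q : UltraFilter q;
  kunen_q_free : forall n, q [set k | (n <= k)%N];
  kunen_ok : forall nu, ok_at nu p;
  kunen_avoid : forall phi : nat -> S, exists2 B, p B & ~ q (phi @^-1` B) }.

(** A map is coded by its graph, a subset of a countable set, and one more bit tells its kind. Thus
    [bits] can index all the requirements on [p]. *)
Lemma bits_surjection (S : countType) :
  exists g : bits -> (S -> nat) + (nat -> S), forall j, exists Y, g Y = j.
Proof.
pose enc (j : (S -> nat) + (nat -> S)) : bits := fun k =>
  match (unpickle k : option ((S * nat) + (nat * S) + unit)%type), j with
  | Some (inl (inl p)), inl nu => nu p.1 == p.2
  | Some (inl (inr p)), inr phi => phi p.1 == p.2
  | Some (inr tt), inl _ => true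
  | _, _ => false
  end.
have encI j j' : enc j = enc j' -> j = j'.
  move=> e.
  have := congr1 (fun u : bits => u (pickle (inr tt : (S * nat) + (nat * S) + unit)%type)) e.
  rewrite /enc pickleK; case: j e => [nu|phi]; case: j' => [nu'|phi'] // e _.
    congr inl; apply: funext => s.
    have := congr1 (fun u : bits =>
      u (pickle (inl (inl (s, nu s)) : (S * nat) + (nat * S) + unit)%type)) e.
    by rewrite /enc pickleK /= eqxx => /esym/eqP.
  congr inr; apply: funext => n.
  have := congr1 (fun u : bits =>
    u (pickle (inl (inr (n, phi n)) : (S * nat) + (nat * S) + unit)%type)) e.
  by rewrite /enc pickleK /= eqxx => /esym/eqP.
exists (fun Y => xget (inl (fun=> 0%N)) [set j | enc j = Y]) => j.
exists (enc j); apply: encI.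
have : exists j', enc j' = enc j by exists j.
by move=> /(xgetPex (inl (fun=> 0%N))).
Qed.

(** First [q] is fixed, as any free ultrafilter; a generic filter then meets the requirements on
    [p]. These only ask for members, so they survive the extension to an ultrafilter. *)
Lemma kunen_pair_exists : exists (S : countType) p q, kunen_pair S p q.
Proof.
have [q [qU qF]] := ultraFilterLemma (eventually_filter : ProperFilter \oo).
have qp : ProperFilter q by exact: ultra_proper.
have [g gsurj] := bits_surjection tree_countType.
pose Q (j : (tree_countType -> nat) + (nat -> tree_countType)) (F : set_system tree_countType) :=
  match j with
  | inl nu => ok_at nu F
  | inr phi => exists2 B, F B & ~ q (phi @^-1` B)
  end.
have [||F [FF Fcof FQ]] := generic_filter tree_matrix g Q tree_matrix_linked gsurj.
- move=> [nu|phi] F G FG /=.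
    case=> [[n Fn]|[A [FA AP]]]; first by left; exists n; exact: FG.
    by right; exists A; split => // X; exact: FG.
  by move=> [B FB nq]; exists B => //; exact: FG.
- move=> [nu|phi]; first exact: achievable_ok tree_matrix_linked.
  exact: achievable_avoid tree_matrix_linked qp.
have [p [pU pF]] := ultraFilterLemma FF.
exists tree_countType, p, q; split => //.
- by move=> B /Fcof; exact: pF.
- move=> n; apply: qF; exact: nbhs_infty_ge.
- move=> nu; case: (FQ (inl nu)) => [[n Fn]|[A [FA AP]]].
    by left; exists n; exact: pF.
  by right; exists A; split => // X; exact: pF.
- by move=> phi; have [B FB nq] := FQ (inr phi); exists B => //; exact: pF.
Qed.

(** * Limits in R2-spaces *)

(** Each [Z n] is finite. At the code of [(n, i)], the bit of [X] is the opposite of that of the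
    [i]-th entry of a list containing [Z n]. *)
Lemma bits_avoid (Z : nat -> set bits) :
  (forall n l, uniq l -> (n < size l)%N -> ~ (forall X, X \in l -> Z n X)) ->
  exists X, forall n, ~ Z n X.
Proof.
move=> ZP.
have fin n : exists l : seq bits, Z n `<=` [set` l].
  have [/finite_seqP[l ->]|/infinite_set_fset h] := pselect (finite_set (Z n)); first by exists l.
  have [B BZ nB] := h n.+1; exfalso; 
  by apply: (ZP n (finmap.enum_fset B) (finmap.fset_uniq B) nB) => X; exact: BZ.
have [r rP] := choice fin.
pose X : bits := fun k => if unpickle k is Some p then
  ~~ nth (fun=> false) (r (p : nat * nat).1) p.2 k else false.
exists X => n /rP /= Xr.
have := nth_index (fun=> false) Xr; set i := index X (r n) => e.
have := congr1 (fun u : bits => u (pickle (n, i))) e.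
by rewrite [in RHS]/X pickleK /=; case: nth.
Qed.

Definition cellular {S : Type} {T : topologicalType} (d : S -> T) (V : S -> set T) :=
  [/\ forall s, open (V s), forall s, V s (d s) &
      forall s s' y, V s y -> V s' y -> s = s'].

Lemma cellular_discrete {S : Type} {T : topologicalType} (d : S -> T) V (A : set S) :
  cellular d V -> discrete_subset (d @` A).
Proof.
move=> [Vo Vd VI] U.
exists (\bigcup_(s in [set s | exists2 u, U u & set_val u = d s]) V s).
  by apply: bigcup_open => s _; exact: Vo.
apply/seteqP; split => u /=.
  move=> [s [u' Uu' e] Vu]; suff -> : u = u' by [].
  apply: val_inj; rewrite -!set_valE e.
  have /set_mem[s' As' e'] := valP u.
  by move: Vu; rewrite set_valE -e' => Vs'; rewrite (VI _ _ _ Vs' (Vd s')).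
move=> Uu; have /set_mem[s As e] := valP u.
by exists s; [exists u => //; rewrite set_valE -e | rewrite set_valE -e].
Qed.

Lemma closure_lim {S : Type} {T : topologicalType} (F : set_system S) (d : S -> T) x A :
  ProperFilter F -> d @ F --> x -> F A -> closure (d @` A) x.
Proof.
move=> FF dx FA N /dx Nx; have FN : F (A `&` d @^-1` N) by exact: filterI.
have [s [As Ns]] := filter_ex FN.
by exists (d s); split => //; exists s.
Qed.

Lemma countable_image {S : countType} {T : Type} (f : S -> T) (A : set S) :
  countable (f @` A).
Proof. by apply: card_le_trans (card_image_le f A) _; exact: countableP. Qed.

Lemma cellular_closure_disjoint {S : countType} {T : topologicalType} (d : S -> T) V
    (A B : set S) : R2_space T -> cellular d V -> A `&` B = set0 ->
  closure (d @` A) `&` closure (d @` B) = set0.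
Proof.
move=> T2 cV AB.
have sep C D : C `&` D = set0 -> closure (d @` C) `&` d @` D = set0.
  move=> CD; apply/seteqP; split => // y [cy [s Ds e]].
  have [Vo Vd VI] := cV.
  have [|z [[c Cc cz] Vz]] := cy (V s).
    by apply: open_nbhs_nbhs; split; [exact: Vo | rewrite -e; exact: Vd].
  have cs : c = s by apply: VI Vz; rewrite -cz; exact: Vd.
  have CDs : (C `&` D) s by split => //; rewrite -cs.
  by rewrite CD in CDs.
apply: T2; [exact: countable_image|exact: countable_image| |].
- by split; [exact: sep | rewrite setIC; apply: sep; rewrite setIC].
- by left; exact: cellular_discrete cV.
Qed.

Lemma hausdorff_separate {T : topologicalType} (x y : T) : hausdorff_space T -> x <> y ->
  exists U V : set T, [/\ open U, open V, U x, V y & U `&` V = set0].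
Proof.
rewrite open_hausdorff => h /eqP /h[[U V]] /= [/set_mem Ux /set_mem Vy] [oU oV /eqP UV].
by exists U, V.
Qed.

(** Disjoint index sets have images with disjoint closures: a limit of [G'] but not of [G] would be
    a limit of the part of [G'] outside [A X], hence not of [A X]. The hypothesis on [range d] is
    the case of an empty list. *)
Lemma cellular_closure_cap {S : countType} {T : topologicalType} (d : S -> T) V
    (A : bits -> set S) (l : seq bits) y :
  R2_space T -> cellular d V -> closure (range d) y ->
  (forall X, X \in l -> closure (d @` A X) y) ->
  closure (d @` [set s | forall X, X \in l -> A X s]) y.
Proof.
move=> T2 cV cy; elim: l => [|X l IH] h.
  by rewrite (_ : [set s | _] = setT) //; apply/seteqP; split.
set G := [set s | _]; set G' := [set s | forall X, X \in l -> A X s] in IH.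
have cG' : closure (d @` G') y by apply: IH => Z Zl; apply: h; rewrite inE Zl orbT.
have cX : closure (d @` A X) y by apply: h; rewrite mem_head.
have [//|nG] := pselect (closure (d @` G) y).
have : (closure (d @` G) `|` closure (d @` (G' `\` A X))) y.
  rewrite -closureU -image_setU; apply: closureS cG'.
  apply: image_subset => s G's; have [As|nAs] := pselect (A X s); last by right.
  by left => Z; rewrite inE => /orP[/eqP ->//|]; exact: G's.
case=> // cD; exfalso.
have : (closure (d @` A X) `&` closure (d @` (G' `\` A X))) y by [].
by rewrite (cellular_closure_disjoint d V) //; apply/seteqP; split => // s [? []].
Qed.

(** Otherwise [e n] differs from [x] for [q]-almost all [n]. The OK property gives an [A X] whose
    image has no such [e n] outside [range d] in its closure; a [B] from [kunen_avoid] disposes of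
    those in [range d]. What remains of [d] and [e] are separated countable sets, the first
    discrete, both accumulating at [x]. *)
Lemma cellular_limit {S : countType} {T : topologicalType} p q (d : S -> T) V x
    (e : nat -> T) :
  kunen_pair S p q -> hausdorff_space T -> R2_space T -> cellular d V ->
  d @ p --> x -> e @ q --> x -> q [set n | e n = x].
Proof.
move=> [pU pfree qU qfree ok avoid] T2 R2 cV dx ex.
have pP : ProperFilter p by exact: ultra_proper.
have qP : ProperFilter q by exact: ultra_proper.
have [Vo Vd VI] := cV.
have [//|qne] := in_ultra_setVsetC [set n | e n = x] qU; exfalso.
have exN n : exists U : set T, e n <> x -> [/\ open U, U (e n) & p [set s | ~ U (d s)]].
  have [->|ne] := pselect (e n = x); first by exists setT.
  have [U [W [oU oW Ue Wx UW]]] := hausdorff_separate _ _ T2 ne.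
  exists U => _; split => //.
  have : p (d @^-1` W) by apply: dx; exact: open_nbhs_nbhs.
  apply: filterS => s Ws Us.
  by have : (U `&` W) (d s) by []; rewrite UW.
have [N NP] := choice exN.
pose bad n s := e n <> x /\ N n (d s).
(* The alternative [pickle s <= n] only ensures that the minimum [nu s] exists; at each [n] it
   concerns finitely many [s], which the free ultrafilter [p] ignores. *)
have badP s : exists n, `[< bad n s \/ (pickle s <= n)%N >].
  by exists (pickle s); apply/asboolP; right.
pose nu s := ex_minn (badP s).
have nu_lt n s : (n < nu s)%N -> ~ bad n s.
  rewrite /nu; case: ex_minnP => m _ mP nm b.
  have : (m <= n)%N by apply: mP; apply/asboolP; left.
  by rewrite leqNgt nm.
have nu_big n : p [set s | (n <= nu s)%N].
  elim: n => [|n IH]; first by apply: filterS filterT.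
  have pb : p [set s | ~ bad n s].
    have [ne|ne] := pselect (e n = x); first by apply: filterS filterT => s _ [].
    by have [_ _] := NP n ne; apply: filterS => s Ns [].
  have pn : p [set s | ~ (pickle s <= n)%N].
    apply: pfree; apply: (@sub_finite_set _ _ (pickle @^-1` [set k | (k < n.+1)%N])).
      by move=> s /= /contrapT.
    apply: finite_preimage; last exact: finite_II.
    by move=> s s' _ _; exact: (pcan_inj pickleK).
  apply: filterS (filterI IH (filterI pb pn)) => s [/= ns [nb np]].
  rewrite ltn_neqAle ns andbT; apply/eqP => e1.
  have : `[< bad n s \/ (pickle s <= n)%N >] by rewrite e1 /nu; case: ex_minnP.
  by move=> /asboolP[].
case: (ok nu) => [[n pn]|[A [pA Afin]]].
  have [s [/= h1 h2]] := filter_ex (filterI pn (nu_big n)).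
  by move: h1; rewrite ltnNge h2.
(* Each [e n] outside [range d] is in the closure of at most [n] of the sets
   [d @` A X], so some [X] works for all [n] at once. *)
have [X XP] : exists X, forall n, ~ [/\ e n <> x, ~ range d (e n) & closure (d @` A X) (e n)].
  apply: bits_avoid => n l ul nl h.
  have [X0 X0l] : exists X0, X0 \in l.
    by case: l nl {ul h} => // a l _; exists a; rewrite mem_head.
  have [ne nd cX0] := h _ X0l.
  have cd : closure (range d) (e n) by apply: closureS cX0; exact: image_subset.
  have := cellular_closure_cap d V A l (e n) R2 cV cd (fun X Xl => let: And3 _ _ c := h X Xl in c).
  set G := [set s | _] => cG.
  (* The part of [G] with [nu s <= n] is finite by the OK property, so its image is closed and
     inside [range d]; where [n < nu s], the point [d s] lies outside [N n]. *)
  have : (closure (d @` (G `&` [set s | (nu s <= n)%N])) `|`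
          closure (d @` [set s | (n < nu s)%N])) (e n).
    rewrite -closureU -image_setU; apply: closureS cG.
    apply: image_subset => s Gs; case: (leqP (nu s) n) => ns; [by left | by right].
  case.
    have cl : closed (d @` (G `&` [set s | (nu s <= n)%N])).
      apply: (accessible_finite_set_closed.1 (hausdorff_accessible T2)).
      apply: finite_image; apply: sub_finite_set (Afin n l ul nl).
      by move=> s [Gs ns].
    by move=> /cl [s _ es]; apply: nd; exists s.
  have [oN Ne _] := NP n ne.
  move=> /(_ (N n)) []; first exact: open_nbhs_nbhs.
  by move=> _ [[s ns <-] Ns]; apply: (nu_lt n s ns).
have [s0 _] := filter_ex (@filterT _ p _).
(* The index of the only [V s] containing [e n], or the arbitrary [s0] if there is none. *)
have exphi n : exists t, forall s, V s (e n) -> t = s.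
  have [[s Vs]|nV] := pselect (exists s, V s (e n)).
    by exists s => s' Vs'; exact: VI Vs Vs'.
  by exists s0 => s Vs; exfalso; apply: nV; exists s.
have [phi phiP] := choice exphi.
have [B pB nqB] := avoid phi.
have qB : q [set n | ~ B (phi n)].
  by have [|//] := in_ultra_setVsetC (phi @^-1` B) qU.
have xD : closure (d @` (A X `&` B)) x by apply: closure_lim dx _; exact: filterI.
have xE : closure (e @` ([set n | e n <> x] `&` [set n | ~ B (phi n)])) x.
  by apply: closure_lim ex _; exact: filterI.
suff emp : closure (d @` (A X `&` B)) `&`
    closure (e @` ([set n | e n <> x] `&` [set n | ~ B (phi n)])) = set0.
  by have := conj xD xE; rewrite -[_ /\ _]/((_ `&` _) x) emp.
apply: R2; [exact: countable_image|exact: countable_image| |]; last first.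
  by left; exact: cellular_discrete cV.
split; apply/seteqP; split => // y [].
  move=> cy [n [/= ne nB] ey]; rewrite -ey in cy.
  apply: (XP n); split => //; last by apply: closureS cy; exact: image_subset.
  move=> [m _ dm]; apply: nB; rewrite (phiP n m); last by rewrite -dm; exact: Vd.
  have [|z [[b [_ Bb] bz] Vz]] := cy (V m).
    by apply: open_nbhs_nbhs; split; [exact: Vo | rewrite -dm; exact: Vd].
  by rewrite (VI m b z) // -bz; exact: Vd.
move=> [b [_ Bb] <-] cy.
have [|z [[n [_ nB] ez] Vz]] := cy (V b).
  by apply: open_nbhs_nbhs; split; [exact: Vo | exact: Vd].
by apply: nB; rewrite (phiP n b) // ez.
Qed.

(** Two points of [W] are separated by [U] and [V]. If [W] meets [V] in an infinite set, this is the
    second piece. If in a finite set, this set is closed: it becomes the first piece, and the rest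
    of [W] the second. *)
Lemma infinite_open_split {T : topologicalType} (W : set T) :
  hausdorff_space T -> open W -> infinite_set W ->
  exists VW : set T * set T, [/\ open VW.1, VW.1 !=set0, open VW.2,
    infinite_set VW.2 & VW.1 `|` VW.2 `<=` W /\ VW.1 `&` VW.2 = set0].
Proof.
move=> T2 oW iW.
have [a Wa] := infinite_setN0 iW.
have [b [Wb ba]] : exists b, W b /\ b <> a.
  have [b [Wb ba]] := infinite_setN0 (infinite_setD iW (finite_set1 a)).
  by exists b; split.
have [U [V [oU oV Ub Va UV]]] := hausdorff_separate _ _ T2 ba.
have oWV : open (W `&` V) by exact: openI.
have [iV|fV] := pselect (infinite_set (W `&` V)).
  exists (W `&` U, W `&` V); split => //=; first exact: openI.
  - by exists b.
  - by split; [move=> z [] [] | rewrite setIACA UV setI0].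
have {}fV : finite_set (W `&` V) by exact: contrapT.
have WVE : W `\` V = W `\` (W `&` V).
  apply/seteqP; split => z [Wz nVz]; split => //; first by move=> [].
  by move=> Vz; apply: nVz.
exists (W `&` V, W `\` V); split => //=.
- by exists a.
- rewrite WVE setDE; apply: openI => //; apply: closed_openC.
  exact: (accessible_finite_set_closed.1 (hausdorff_accessible T2)).
- rewrite WVE; exact: infinite_setD.
- by split; [move=> z [] [] | apply/seteqP; split => // z [[_ Vz] [_]]].
Qed.

Lemma infinite_cellular {T : topologicalType} :
  hausdorff_space T -> infinite_set [set: T] ->
  exists (d : nat -> T) (V : nat -> set T), cellular d V.
Proof.
move=> T2 iT.
pose good (W : set T) := open W /\ infinite_set W.
have ex (W : set T) : exists VW : set T * set T, good W ->
    [/\ open VW.1, VW.1 !=set0, good VW.2, VW.1 `|` VW.2 `<=` W & VW.1 `&` VW.2 = set0].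
  have [[oW iW]|nW] := pselect (good W); last by exists (set0, set0).
  by have [VW [? ? ? ? [? ?]]] := infinite_open_split W T2 oW iW; exists VW.
have [f fP] := choice ex.
pose W n := iter n (fun W => (f W).2) setT.
have Wg n : good (W n).
  elim: n => [|n IH]; first by split; [exact: openT|].
  by have [_ _ ? _ _] := fP _ IH.
pose V n := (f (W n)).1.
have VW n : V n `|` W n.+1 `<=` W n by have [] := fP _ (Wg n).
have WW m n : (m <= n)%N -> W n `<=` W m.
  elim: n => [|n IH]; first by rewrite leqn0 => /eqP ->.
  rewrite leq_eqVlt => /orP[/eqP -> //|mn] z Wz.
  by apply: IH mn _ _; apply: (VW n); right.
have Vlt m n z : (m < n)%N -> V m z -> V n z -> False.
  move=> mn Vm Vn; have [_ _ _ _ VW0] := fP _ (Wg m).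
  have : ((f (W m)).1 `&` (f (W m)).2) z.
    by split => //; apply: (WW _ _ mn); apply: (VW n); left.
  by rewrite VW0.
have exd n : exists z, V n z by have [_ ? _ _ _] := fP _ (Wg n).
have [d dP] := choice exd.
exists d, V; split => //.
- by move=> n; have [] := fP _ (Wg n).
- move=> m n z Vm Vn; case: (ltngtP m n) => // mn; exfalso.
    exact: Vlt mn Vm Vn.
  exact: Vlt mn Vn Vm.
Qed.

Lemma R2_no_convergent_sequence {T : topologicalType} (c : nat -> T) V (y : T) :
  R2_space T -> cellular c V -> ~ (c @ \oo --> y).
Proof.
move=> R2 cV cy.
have acc b : closure (c @` [set n | odd n = b]) y.
  move=> N /cy [n _ nN]; exists (c (n.*2 + b)%N); split.
    by exists (n.*2 + b)%N => //=; rewrite oddD odd_double; case: b.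
  by apply: nN => /=; rewrite -addnn -addnA leq_addr.
have := conj (acc true) (acc false).
rewrite -[_ /\ _]/((_ `&` _) y) (cellular_closure_disjoint c V) //.
by apply/seteqP; split => // n [/= ->].
Qed.

(** * Products *)

Lemma cvg_prod_topology (I : Type) (X : I -> topologicalType)
    (F : set_system (prod_topology X)) (x : prod_topology X) : Filter F ->
  (forall i, (fun z : prod_topology X => z i) @ F --> x i) -> F --> x.
Proof.
move=> FF h; apply/cvg_sup => i U [V] [[W] oW <-] Wx WU.
by apply: (filterS WU); apply: h; exact: open_nbhs_nbhs.
Qed.

(** The sets [A] fulfilling the conclusion form a filter converging to [x] in each coordinate, hence
    containing all neighbourhoods of [x]. *)
Lemma nbhs_prod_topology_support (I : Type) (X : I -> topologicalType)
    (x : prod_topology X) (A : set (prod_topology X)) : nbhs x A ->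
  exists2 D : set I, finite_set D &
    forall z : prod_topology X, (forall i, D i -> z i = x i) -> A z.
Proof.
pose F : set_system (prod_topology X) := [set A | exists2 D : set I, finite_set D &
  forall z : prod_topology X, (forall i, D i -> z i = x i) -> A z].
have FF : Filter F.
  split.
  - by exists set0.
  - move=> P Q [D fD DP] [E fE EQ]; exists (D `|` E); first by rewrite finite_setU.
    by move=> z h; split; [apply: DP|apply: EQ] => i ?; apply: h; [left|right].
  - by move=> P Q PQ [D fD DP]; exists D => // z /DP; exact: PQ.
suff : F --> x by exact.
apply: cvg_prod_topology => i N /nbhs_singleton Nx.
by exists [set i] => // z /(_ i erefl) e; rewrite /= e.
Qed.

Lemma compact_ultra_limit {S : Type} {T : topologicalType} (p : set_system S) (d : S -> T) :
  UltraFilter p -> compact [set: T] -> exists x : T, d @ p --> x.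
Proof.
move=> pU cT; have pP : ProperFilter p by exact: ultra_proper.
have [|x [_ xc]] := cT (d @ p) _; first exact: filterT.
exists x => N Nx; have [//|nN] := in_ultra_setVsetC (d @^-1` N) pU.
by have [z [nz Nz]] := xc (~` N) N nN Nx.
Qed.

Lemma cellular_comp {S S' : Type} {T : topologicalType} (d : S -> T) V (f : S' -> S) :
  injective f -> cellular d V -> cellular (d \o f) (V \o f).
Proof.
move=> fI [Vo Vd VI]; split => [s|s|s s' y Vs Vs']; [exact: Vo|exact: Vd|].
by apply: fI; exact: VI Vs Vs'.
Qed.

Theorem corollary9 (I : Type) (X : I -> topologicalType)
  (I_nonempty : [set: I] !=set0)
  (X_hausdorff : forall i, hausdorff_space (X i))
  (X_completely_regular : forall i, completely_regular_space (X i))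
  (X_infinite : forall i, infinite_set [set: X i])
  (X_compact : forall i, compact [set: X i])
  (X_R2 : forall i, R2_space (X i)) :
  ~ homogeneous_space (prod_topology X).
Proof.
move=> hom; have [i0 _] := I_nonempty.
have [S [p [q pq]]] := kunen_pair_exists.
have [pU _ qU qfree _ _] := pq.
have pP : ProperFilter p by exact: ultra_proper.
have qP : ProperFilter q by exact: ultra_proper.
have exd i : exists dV : (S -> X i) * (S -> set (X i)), cellular dV.1 dV.2.
  have [d [V cV]] := infinite_cellular (X_hausdorff i) (X_infinite i).
  exists (d \o pickle, V \o pickle); apply: cellular_comp cV.
  exact: (pcan_inj pickleK).
pose d i := (projT1 (cid (exd i))).1; pose V i := (projT1 (cid (exd i))).2.
have dV i : cellular (d i) (V i) by rewrite /d /V; case: cid.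
have exx i : exists x : X i, d i @ p --> x by exact: compact_ultra_limit.
pose x : prod_topology X := fun i => projT1 (cid (exx i)).
have dx i : d i @ p --> x i by rewrite /x; case: cid.
have [e [W eW]] := infinite_cellular (X_hausdorff i0) (X_infinite i0).
have [y0 ey0] := compact_ultra_limit q e qU (X_compact i0).
pose upd (a : X i0) : prod_topology X := @dfwith {classic I} X x i0 a.
have upd0 a : upd a i0 = a by exact: (@dfwithin {classic I}).
have updN a i : i0 <> i -> upd a i = x i.
  by move=> n; apply: (@dfwithout {classic I}); exact/eqP.
have [h [hc [h' [h'c hK h'K]]] hx] := hom x (upd y0).
pose z n : prod_topology X := h' (upd (e n)).
have zx : z @ q --> x.
  have <- : h' (upd y0) = x by rewrite -hx hK.
  apply: (cvg_comp (upd \o e) h') (h'c _).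
  apply: cvg_prod_topology => i.
  have [<-|ni] := pselect (i0 = i).
    rewrite upd0 -[X in X --> _]/(((fun z => z i0) \o (upd \o e)) @ q).
    by rewrite (_ : _ \o _ = e) //; apply: funext => n /=; exact: upd0.
  rewrite updN //.
  rewrite -[X in X --> _]/(((fun z => z i) \o (upd \o e)) @ q).
  rewrite (_ : _ \o _ = fun=> x i); first exact: cvg_cst.
  by apply: funext => n /=; exact: updN.
have zix i : q [set n | z n i = x i].
  apply: (cellular_limit p q (d i) (V i) (x i) (fun n => z n i) pq) => //.
  apply: (cvg_comp z (fun u : prod_topology X => u i)) zx _.
  exact: (@proj_continuous {classic I}).
pose g (u : prod_topology X) : X i0 := h u i0.
have gc : continuous g.
  move=> u; apply: (cvg_comp h (fun u : prod_topology X => u i0)) (hc u) _.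
  exact: (@proj_continuous {classic I}).
have gz n : g (z n) = e n by rewrite /g /z h'K upd0.
have [Wo We WI] := eW.
have exD n : exists D : set I, finite_set D /\
    forall u : prod_topology X, (forall i, D i -> u i = z n i) -> W n (g u).
  have [|D fD DP] := nbhs_prod_topology_support I X (z n) (g @^-1` W n).
    by apply: gc; apply: open_nbhs_nbhs; split; [exact: Wo | rewrite gz; exact: We].
  by exists D.
have [D DP] := choice exD.
pose w n : prod_topology X := fun i => if pselect (D n i) then z n i else x i.
have Ww n : W n (g (w n)).
  by apply: (DP n).2 => i Di; rewrite /w; case: pselect.
have wx n i : ~ D n i -> w n i = x i by rewrite /w; case: pselect.
have wz n i : z n i = x i -> w n i = x i by rewrite /w; case: pselect.
have next (l : seq nat) : exists n, (forall m, m \in l -> (m < n)%N) /\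
    forall m, m \in l -> forall i, D m i -> w n i = x i.
  suff : q [set n | (forall m, m \in l -> (m < n)%N) /\
      forall m, m \in l -> forall i, D m i -> w n i = x i] by exact: filter_ex.
  elim: l => [|a l IH]; first by apply: filterS filterT.
  have qa : q [set n | forall i, D a i -> z n i = x i].
    have /(@finite_seqP {classic I})[r rE] := (DP a).1.
    rewrite rE; elim: r {rE} => [|i r IHr]; first by apply: filterS filterT.
    apply: filterS (filterI (zix i) IHr) => n [zi zr] j.
    by rewrite /= inE => /orP[/eqP ->|/zr].
  apply: filterS (filterI IH (filterI qa (qfree a.+1))) => n [[h1 h2] [h3 h4]].
  split => m; rewrite inE => /orP[/eqP ->|ml]; [exact: h4|exact: h1| |exact: h2].
  by move=> i Di; apply: wz; exact: h3.
have [nx nxP] := choice next.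
(* [L k] lists the indices chosen before [n_ k], so each choice respects all the previous ones. *)
pose L k := iter k (fun l => nx l :: l) [::].
pose n_ k := nx (L k).
have nL j k : (j < k)%N -> n_ j \in L k.
  elim: k => // k IH; rewrite ltnS leq_eqVlt /= inE => /orP[/eqP ->|/IH ->].
    by rewrite eqxx.
  by rewrite orbT.
have nI : injective n_.
  move=> j k e1; case: (ltngtP j k) => // /nL /(nxP _).1.
    by rewrite -/(n_ k) e1 ltnn.
  by rewrite -/(n_ j) e1 ltnn.
have wx_cvg : (w \o n_) @ \oo --> x.
  apply: cvg_prod_topology => i.
  (* If [i] lies in some [D (n_ j)], the choice of every later index makes [w] agree with [x] at
     [i]; if in none, they agree there throughout. *)
  have ev : \forall k \near \oo, w (n_ k) i = x i.
    have [[j Dj]|nD] := pselect (exists j, D (n_ j) i); last first.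
      by apply: nearW => k; apply: wx => Dk; apply: nD; exists k.
    exists j.+1 => // k /= jk; apply: (nxP _).2 Dj; exact: nL.
  move=> N /nbhs_singleton Nx; apply: filterS ev => k /= wk.
  by rewrite wk.
apply: (R2_no_convergent_sequence (g \o w \o n_) (W \o n_) (g x) (X_R2 i0)).
  split => [k|k|k k' u Wk Wk'] /=; [exact: Wo|exact: Ww|].
  by apply: nI; exact: WI Wk Wk'.
exact: (cvg_comp (w \o n_) g) wx_cvg (gc x).
Qed.
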